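(* Let $G$ be a finite connected loopless undirected multigraph of genus $g=|E(G)|-|V(G)|+1$, and let $D$ be a divisor on $G$ with $\deg(D)\le g-1$. Then: (i) $r(D)=-1$ if and only if there exist a divisor $D'$ and an acyclic partial orientation $\mathcal{O}$ of $G$ with $D\sim D'\le D_{\mathcal{O}}$. (ii) $r(D)\ge 0$ if and only if there exists a sourceless partial orientation $\mathcal{O}$ of $G$ with $D\sim D_{\mathcal{O}}$.
   Context: A divisor on $G$ is a function $D:V(G)\to\mathbb{Z}$; $\deg(D)=\sum_v D(v)$; $D_1\le D_2$ means $D_1(v)\le D_2(v)$ for all $v$; $D$ is effective if $D\ge 0$. Two divisors are linearly equivalent, $D\sim D'$, if $D-D'$ lies in the $\mathbb{Z}$-span of the columns of the Laplacian matrix of $G$. The (Baker--Norine) rank $r(D)$ is $\min \deg(E)-1$ over all effective divisors $E$ such that $D-E$ is not linearly equivalent to any effective divisor (so $r(D)=-1$ iff $D$ is not linearly equivalent to an effective divisor). A partial orientation $\mathcal{O}$ of $G$ is a choice of direction for each edge in some subset of $E(G)$; the remaining edges are unoriented. Its associated divisor is $D_{\mathcal{O}}(v)=\mathrm{indeg}_{\mathcal{O}}(v)-1$, where $\mathrm{indeg}_{\mathcal{O}}(v)$ is the number of edges oriented towards $v$. $\mathcal{O}$ is acyclic if it contains no directed cycle; a source is a vertex with no incoming oriented edge; $\mathcal{O}$ is sourceless if it has no sources. *)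

(* Defs.v *)
From HB Require Import structures.
From mathcomp Require Import all_boot all_order all_algebra.
From mathcomp Require Import boolp.

Set Implicit Arguments.
Unset Strict Implicit.
Unset Printing Implicit Defensive.

Import Order.TTheory GRing.Theory Num.Theory.

Local Open Scope ring_scope.

(* Edges form their own type, so parallel edges are distinct; looplessness is
   the requirement that each edge has exactly two endpoints. *)
Record multigraph := Multigraph {
  vertex : finType;
  edge : finType;
  ends : edge -> {set vertex};
  ends_card : forall e, #|ends e| = 2%N;
  vertex_card_gt0 : (0 < #|vertex|)%N }.

Section Divisors.

Variable G : multigraph.
Implicit Types (u v : vertex G) (e : edge G).

Definition adjacent : rel (vertex G) :=
  fun u v => [exists e, ends e == [set u; v]].

Definition connected_graph : Prop := forall u v, connect adjacent u v.

Definition genus : int := #|edge G|%:Z - #|vertex G|%:Z + 1.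

Definition valency v : nat := #|[set e | v \in ends e]|.

Definition multiplicity u v : nat := #|[set e | ends e == [set u; v]]|.

Definition laplacian u v : int :=
  if u == v then (valency v)%:Z else - (multiplicity u v)%:Z.

Definition laplacian_col v : {ffun vertex G -> int} :=
  [ffun u => laplacian u v].

Definition divisor := {ffun vertex G -> int}.

Implicit Types D E : divisor.

Definition deg D : int := \sum_v D v.

Definition div_le D1 D2 : Prop := forall v, D1 v <= D2 v.

Definition effective D : Prop := div_le 0 D.

Definition lin_equiv D1 D2 : Prop :=
  exists f : vertex G -> int, D1 - D2 = \sum_v laplacian_col v *~ f v.

Definition equiv_effective D : Prop :=
  exists2 D', effective D' & lin_equiv D D'.

(* The degrees of the divisors [E] over which the rank takes a minimum; as the
   degree of an effective divisor is nonnegative, these are naturals. *)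
Definition rank_obstruction D : pred nat := fun n =>
  `[< exists E, [/\ effective E, deg E = n%:Z & ~ equiv_effective (D - E)] >].

Lemma sum_multiplicity v :
  (\sum_(u | u != v) multiplicity u v)%N = valency v.
Proof.
have H e : (\sum_(u | u != v) (ends e == [set u; v]))%N = (v \in ends e).
  case: (boolP (v \in ends e)) => [ve|vNe]; last first.
    rewrite big1 // => u _; case: eqP => // ee.
    by move: vNe; rewrite ee !inE eqxx orbT.
  have /eqP/cards1P[w ew] : #|ends e :\ v| = 1%N.
    by have := cardsD1 v (ends e); rewrite ve ends_card => -[].
  have ee : ends e = [set w; v] by rewrite -(setD1K ve) ew setUC.
  have wv : w != v by have : w \in ends e :\ v by [rewrite ew set11]; rewrite !inE => /andP[].
  rewrite (bigD1 w) //= ee eqxx big1 // => u /andP[uv uw].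
  case: eqP => // /setP/(_ u).
  by rewrite !inE eqxx (negPf uv) (negPf uw).
have cardE (P : pred (edge G)) : #|[set e | P e]| = (\sum_e P e)%N.
  by rewrite -sum1_card big_mkcond; apply: eq_bigr => e _; rewrite inE; case: (P e).
rewrite /valency cardE /multiplicity.
under eq_bigr do rewrite cardE.
by rewrite exchange_big; apply: eq_bigr => e _; rewrite H.
Qed.

Lemma deg_laplacian_col v : deg (laplacian_col v) = 0.
Proof.
rewrite /deg (bigD1 v) //= ffunE /laplacian eqxx -sum_multiplicity.
rewrite -[Posz _]natz natr_sum -big_split /= big1 // => u uv.
by rewrite ffunE /laplacian (negPf uv) natz subrr.
Qed.

Lemma deg_lin_equiv D1 D2 : lin_equiv D1 D2 -> deg D1 = deg D2.
Proof.
case=> f fE; apply/eqP; rewrite -subr_eq0; apply/eqP.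
have -> : deg D1 - deg D2 = deg (D1 - D2).
  by rewrite /deg -sumrB; apply: eq_bigr => v _; rewrite !ffunE.
rewrite fE /deg; under eq_bigr do rewrite sum_ffunE.
rewrite exchange_big big1 //= => v _.
have mulE (a : int) (E : divisor) u : (E *~ a) u = E u *~ a.
  by case: a => n; rewrite ?NegzE ?mulrNz ?ffunE -?pmulrn ffunMnE.
under eq_bigr do rewrite mulE.
by rewrite -mulrz_suml -[X in X *~ _]/(deg (laplacian_col v)) deg_laplacian_col mul0rz.
Qed.

Lemma rank_obstruction_exists D : exists n, rank_obstruction D n.
Proof.
have [v0 _] := card_gt0P (vertex_card_gt0 G).
exists `|deg D|.+1; apply/asboolP.
pose E : divisor := [ffun v => if v == v0 then (`|deg D|%N.+1)%:Z else 0].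
have degE : deg E = (`|deg D|.+1)%:Z.
  rewrite /deg (bigD1 v0) //= ffunE eqxx big1 ?addr0 // => v vv0.
  by rewrite ffunE (negPf vv0).
exists E; split=> //; first by move=> v; rewrite !ffunE; case: eqP.
case=> D' eff /deg_lin_equiv; apply/eqP; rewrite lt_eqF //.
apply: (@lt_le_trans _ _ 0); last first.
  by apply: sumr_ge0 => v _; have := eff v; rewrite ffunE.
have -> : deg (D - E) = deg D - deg E.
  by rewrite /deg -sumrB; apply: eq_bigr => v _; rewrite !ffunE.
by rewrite degE subr_lt0 (le_lt_trans (ler_norm _)) // -abszE ltz_nat.
Qed.

Definition rank D : int := (ex_minn (rank_obstruction_exists D))%:Z - 1.

End Divisors.

Section Orientations.

Variable G : multigraph.

(* [head e = Some v]: [e] is directed towards [v]; [None]: unoriented. *)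
Record partial_orientation := PartialOrientation {
  head : edge G -> option (vertex G);
  head_ends : forall e v, head e = Some v -> v \in ends e }.

Implicit Types (u v : vertex G) (O : partial_orientation).

Definition indeg O v : nat := #|[set e | head O e == Some v]|.

Definition orientation_div O : divisor G := [ffun v => (indeg O v)%:Z - 1].

Definition arc O : rel (vertex G) :=
  fun u v => [exists e, (ends e == [set u; v]) && (head O e == Some v)].

(* As each edge has at most one direction, a cycle of length two here uses two
   distinct parallel edges. *)
Definition acyclic O : Prop :=
  forall c : seq (vertex G), c != [::] -> ~ ucycle (arc O) c.

Definition source O v : Prop :=
  forall e, head O e <> Some v.

Definition sourceless O : Prop := forall v, ~ source O v.

End Orientations.

(* Main.v *)
(* A divisor below an acyclic orientation divisor is not equivalent to an
   effective one: on the set where the firing script is maximal, the orientation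
   has a source, and the divisor is too small there. Conversely, if [D] is not
   equivalent to an effective divisor, take an equivalent divisor of minimal
   total debt and fire sets avoiding a vertex in debt for as long as possible;
   when Dhar's fire, started at the vertices in debt, burns the whole graph, the
   burning order defines the acyclic orientation.

   If [D] is equivalent to an effective divisor, choose an effective [E] and a
   partial orientation [O] with [D ~ E >= D_O], with as many oriented edges as
   possible and then with the largest set [S] reachable from the vertices where
   [E > D_O]. If [S] is nonempty, then no unoriented edge meets [S], as it could
   be used to augment [O]. Hence the edges of the cut of [S] all point into [S],
   and since the degree is at most [g - 1], [S] is not everything. Firing [S] and
   reversing the cut preserves [E - D_O] and effectiveness but enlarges [S].
   Thus [E = D_O], and [O] is sourceless since [E] is effective. *)

From mathcomp Require Import all_boot all_order all_algebra.
From mathcomp Require Import boolp zify.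
Require Import Defs.

Set Implicit Arguments.
Unset Strict Implicit.
Unset Printing Implicit Defensive.

Import Order.TTheory GRing.Theory Num.Theory.

Local Open Scope ring_scope.

(** * Extremal choices and directed cycles *)

Lemma max_measure_exists (T : Type) (P : T -> Prop) (m : T -> nat) (b : nat) :
  (exists x, P x) -> (forall x, P x -> (m x <= b)%N) ->
  exists2 x, P x & forall y, P y -> (m y <= m x)%N.
Proof.
move=> [x0 Px0] mb.
pose Q : pred nat := fun n => `[< exists2 x, P x & m x = n >].
have exQ : exists n, Q n by exists (m x0); apply/asboolP; exists x0.
have Qb n : Q n -> (n <= b)%N by move/asboolP => [x Px <-]; exact: mb.
case: (ex_maxnP exQ Qb) => n /asboolP[x Px <-] maxn.
by exists x => // y Py; apply: maxn; apply/asboolP; exists y.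
Qed.

(** Take [v] in [A] with the fewest ancestors. A predecessor [u] of [v] in [A] has the same
    ancestors, so [v] reaches [u] and the arc from [u] to [v] closes a cycle. *)
Lemma cycle_of_predecessors (T : finType) (r : rel T) (A : {set T}) (x : T) :
  x \in A -> (forall v, v \in A -> exists2 u, u \in A & r u v) ->
  exists2 c : seq T, c != [::] & ucycle r c.
Proof.
move=> xA pred.
pose anc v := [set u | connect r u v].
case: (@arg_minnP _ x (mem A) (fun v => #|anc v|) xA) => v vA vmin.
have [u uA ruv] := pred v vA.
have sub : anc u \subset anc v.
  apply/subsetP => w; rewrite !inE => wu; exact: connect_trans wu (connect1 ruv).
have /eqP ancE : anc u == anc v by rewrite eqEcard sub /=; exact: vmin.
have : v \in anc u by rewrite ancE inE.
rewrite inE => /connectP[p]; case/shortenP => p' pp' up' _ uE.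
exists (v :: p') => //.
by rewrite /ucycle up' [cycle _ _]rcons_path pp' -uE ruv.
Qed.

(* [bigD1] yields the addition of a monoid law, which [lia] does not recognise. *)
Lemma int_bigD1 (I : finType) (j : I) (P : pred I) (F : I -> int) : P j ->
  \sum_(i | P i) F i = F j + \sum_(i | P i && (i != j)) F i.
Proof. by move=> Pj; rewrite (bigD1 j). Qed.

Section Graph.

Variable G : multigraph.
Implicit Types (u v w : vertex G) (e : edge G) (D E : divisor G).
Implicit Types (O : partial_orientation G) (A S : {set vertex G}).

(** * Divisor values and the ends of an edge *)

Lemma effectiveP D : effective D <-> forall v, 0 <= D v.
Proof. by split=> effD v; have := effD v; rewrite ffunE. Qed.

Lemma divBE D E v : (D - E) v = D v - E v.
Proof. by rewrite !ffunE. Qed.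

Lemma orientation_divE O v : orientation_div O v = (indeg O v)%:Z - 1.
Proof. by rewrite ffunE. Qed.

(** Meant for [v] an end of [e]. The default is never reached, as [ends e] has two elements. *)
Definition opposite e v : vertex G := odflt v [pick w in ends e :\ v].

Lemma oppositeP e v : v \in ends e ->
  opposite e v != v /\ ends e = [set opposite e v; v].
Proof.
move=> ve; have /eqP/cards1P[w ew] : #|ends e :\ v| = 1%N.
  by have := cardsD1 v (ends e); rewrite ve ends_card => -[].
have -> : opposite e v = w.
  rewrite /opposite ew; case: pickP => [u /set1P //|/(_ w)].
  by rewrite /= set11.
split; last by rewrite -(setD1K ve) ew setUC.
by have : w \in ends e :\ v by [rewrite ew set11]; rewrite !inE => /andP[].
Qed.

Lemma opposite_neq e v : v \in ends e -> opposite e v != v.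
Proof. by case/oppositeP. Qed.

Lemma ends_opposite e v : v \in ends e -> ends e = [set opposite e v; v].
Proof. by case/oppositeP. Qed.

Lemma opposite_ends e v : v \in ends e -> opposite e v \in ends e.
Proof. by move/ends_opposite => {1}->; rewrite set21. Qed.

Lemma oppositeE e u v : u != v -> ends e = [set u; v] -> opposite e v = u.
Proof.
move=> uv ee; have ve : v \in ends e by rewrite ee set22.
have := opposite_ends ve; rewrite ee !inE (negPf (opposite_neq ve)) orbF.
by move/eqP.
Qed.

Lemma oppositeK e v : v \in ends e -> opposite e (opposite e v) = v.
Proof.
move=> ve; apply: oppositeE; first by rewrite eq_sym opposite_neq.
by rewrite setUC -ends_opposite.
Qed.

(** * Laplacian and linear equivalence *)

Lemma sum_multiplicity_opposite (F : vertex G -> int) v :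
  \sum_(u | u != v) F u *+ multiplicity u v
    = \sum_(e | v \in ends e) F (opposite e v).
Proof.
have multE u : (multiplicity u v = \sum_e (ends e == [set u; v]))%N.
  rewrite /multiplicity -sum1_card big_mkcond; apply: eq_bigr => e _.
  by rewrite inE; case: eqP.
under eq_bigr do rewrite multE -sumrMnr.
rewrite exchange_big [RHS]big_mkcond; apply: eq_bigr => e _ /=.
case: ifP => [ve|/negbT vNe]; last first.
  rewrite big1 // => u _; case: eqP => // ee.
  by move: vNe; rewrite ee set22.
rewrite (bigD1 (opposite e v)) ?opposite_neq //= -ends_opposite // eqxx.
rewrite big1 ?addr0 // => u /andP[uv uo]; case: eqP => // ee.
by rewrite (oppositeE uv ee) eqxx in uo.
Qed.

(** The loss at each vertex when every [v] fires [f v] times. *)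
Definition lap (f : vertex G -> int) : divisor G :=
  \sum_v laplacian_col v *~ f v.

(** The edge form allows comparison with indegrees term by term. *)
Lemma lapE f v : lap f v = \sum_(e | v \in ends e) (f v - f (opposite e v)).
Proof.
have mulE (a : int) (E : divisor G) u : (E *~ a) u = E u *~ a.
  by case: a => n; rewrite ?NegzE ?mulrNz ?ffunE -?pmulrn ffunMnE.
rewrite /lap sum_ffunE sumrB.
rewrite -(sum_multiplicity_opposite f) -(sum_multiplicity_opposite (fun=> f v)).
under eq_bigr do rewrite mulE ffunE.
rewrite (bigD1 v) //= /laplacian eqxx -sum_multiplicity.
rewrite -[Posz _]natz natr_sum mulrz_suml; congr (_ + _).
  by apply: eq_bigr => u uv; rewrite -mulrzl -mulr_natr; lia.
rewrite -sumrN; apply: eq_bigr => u uv.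
by rewrite eq_sym (negPf uv) /multiplicity setUC -mulrzl -mulr_natr; lia.
Qed.

Lemma lapD f g : lap (fun v => f v + g v) = lap f + lap g.
Proof. by rewrite /lap -big_split; apply: eq_bigr => v _; rewrite mulrzDr. Qed.

Lemma lapN f : lap (fun v => - f v) = - lap f.
Proof. by rewrite /lap -sumrN; apply: eq_bigr => v _; rewrite mulrNz. Qed.

Lemma lap0 : lap (fun=> 0) = 0.
Proof. by rewrite /lap big1 // => v _; rewrite mulr0z. Qed.

Lemma lin_equivP D E : lin_equiv D E <-> exists f, E = D - lap f.
Proof.
split=> -[f fE]; exists f; first by rewrite -[lap f]/(\sum_v _) -fE opprB addrC subrK.
by rewrite fE opprB addrC subrK.
Qed.

Lemma lin_equiv_refl D : lin_equiv D D.
Proof. by apply/lin_equivP; exists (fun=> 0); rewrite lap0 subr0. Qed.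

Lemma lin_equiv_sym D E : lin_equiv D E -> lin_equiv E D.
Proof.
case/lin_equivP => f ->; apply/lin_equivP; exists (fun v => - f v).
by rewrite lapN opprK subrK.
Qed.

Lemma lin_equiv_trans D E F : lin_equiv D E -> lin_equiv E F -> lin_equiv D F.
Proof.
case/lin_equivP => f -> /lin_equivP[g ->]; apply/lin_equivP.
by exists (fun v => f v + g v); rewrite lapD opprD addrA.
Qed.

(** * Rank and effective divisors *)

(** Zero is the only effective divisor of degree 0, so the least obstruction degree is 0 exactly
    when [D] itself is the obstructed divisor. *)
Lemma rank_lt0 D : rank D = -1 <-> ~ equiv_effective D.
Proof.
rewrite /rank; case: ex_minnP => n /asboolP[E [effE degE nE]] nmin.
split=> [n0 effD|nD].
  have {}n0 : n = 0%N by lia.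
  apply: nE; suff -> : E = 0 by rewrite subr0.
  rewrite n0 in degE; apply/ffunP => v; rewrite ffunE.
  apply: psumr_eq0P degE v isT => u _.
  by move/effectiveP: effE => /(_ u).
suff /nmin : rank_obstruction D 0 by rewrite leqn0 => /eqP->.
apply/asboolP; exists 0; split; rewrite ?subr0 //.
by rewrite /deg big1 // => v _; rewrite ffunE.
Qed.

Lemma rank_ge0 D : 0 <= rank D <-> equiv_effective D.
Proof.
have : rank D = -1 \/ 0 <= rank D by rewrite /rank; lia.
have := rank_lt0 D.
case: (pselect (equiv_effective D)) => H [H1 H2] [H3|H3]; split=> // H4; try lia.
- by case: (H1 H3).
- by move: (H2 H); lia.
Qed.

(** * Acyclic orientations exclude effective divisors *)

Definition indicator S : vertex G -> int := fun v => (v \in S)%:R.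

Lemma indeg_sum O v :
  (indeg O v)%:Z = \sum_(e | v \in ends e) (head O e == Some v)%:R.
Proof.
rewrite /indeg -sum1_card -natz natr_sum big_mkcond [RHS]big_mkcond.
apply: eq_bigr => e _; rewrite inE; case: eqP => [/head_ends ->//|_].
by case: ifP.
Qed.

Lemma arcP O u v :
  reflect (exists e, [/\ v \in ends e, opposite e v = u & head O e = Some v])
          (arc O u v).
Proof.
apply: (iffP existsP) => [[e /andP[/eqP ee /eqP he]]|[e [ve <- he]]].
  have ve := head_ends he; exists e; split=> //; apply: oppositeE => //.
  by apply: contra_eq_neq (ends_card e) => uv; rewrite ee uv setUid cards1.
by exists e; rewrite he -ends_opposite // !eqxx.
Qed.

Lemma acyclic_not_equiv_effective O D :
  acyclic O -> div_le D (orientation_div O) -> ~ equiv_effective D.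
Proof.
move=> acO leD [E effE /lin_equivP[f EE]].
have [v0 _] := card_gt0P (vertex_card_gt0 G).
have [x _ xmax] : exists2 x, True & forall y, f y <= f x.
  case: (@Order.TotalTheory.arg_maxP _ _ _ v0 predT f) => // x _ xmax.
  by exists x => // y; exact: xmax.
pose A := [set v | f v == f x].
have xA : x \in A by rewrite inE.
(* Otherwise every vertex of [A] has a predecessor in [A], which yields a directed cycle. *)
have [v vA vsrc] : exists2 v, v \in A & forall u, u \in A -> ~~ arc O u v.
  apply: contrapT => nsrc.
  have [|c c0 cyc] := @cycle_of_predecessors _ (arc O) A x xA; last exact: acO c0 cyc.
  move=> v vA; apply: contrapT => npred; apply: nsrc; exists v => // u uA.
  by apply/negP => uv; apply: npred; exists u.
(* Edges into [v] come from outside [A], where [f] is smaller by at least 1; all other terms are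
   nonnegative since [f v] is maximal. *)
have : (indeg O v)%:Z <= lap f v.
  rewrite indeg_sum lapE; apply: ler_sum => e ve.
  have vE : f v = f x by move: vA; rewrite inE => /eqP.
  have le := xmax (opposite e v).
  case: eqP => [he|_]; last by rewrite vE subr_ge0.
  have : opposite e v \notin A.
    by apply: contraPN (isT) => /vsrc /negP[]; apply/arcP; exists e.
  by rewrite inE vE => /eqP; lia.
have := leD v; have /effectiveP/(_ v) := effE; rewrite EE divBE orientation_divE; lia.
Qed.

(** * Burning and acyclic orientations *)

(** Each edge is directed to its strictly higher end, and ties stay unoriented. Heights increase
    along arcs, so no cycle closes. *)
Lemma height_orientation (rho : vertex G -> nat) :
  exists O, acyclic O /\ forall v, (indeg O v)%:Z =
    \sum_(e | v \in ends e) (rho (opposite e v) < rho v)%N%:R.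
Proof.
pose high e v := (v \in ends e) && (rho (opposite e v) < rho v)%N.
have high_pick e v : high e v -> [pick u | high e u] = Some v.
  case: pickP => [u|->//] /andP[ue hu] /andP[ve hv]; congr Some.
  apply: contraTeq hu => uv.
  have oe : opposite e v = u.
    by apply: oppositeE => //; move: ue; rewrite {1 2}(ends_opposite ve) !inE
         (negPf uv) orbF => /eqP->.
  by rewrite -oe oppositeK // oe -leqNgt -oe ltnW.
have hd e v : [pick u | high e u] = Some v -> v \in ends e.
  by case: pickP => // u /andP[ue _] [<-].
exists (PartialOrientation hd); split=> [c|v]; last first.
  rewrite indeg_sum; apply: eq_bigr => e ve /=; congr (nat_of_bool _)%:R.
  apply/eqP/idP => [|hv]; last by apply: high_pick; rewrite /high ve.
  by case: pickP => // u /andP[_ hu] [<-].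
have arc_lt u v : arc (PartialOrientation hd) u v -> (rho u < rho v)%N.
  case/arcP => e [ve <- /=]; case: pickP => // w /andP[_ hw] [<-] //.
case: c => // x p _ /andP[/= /(sub_path arc_lt) xp _].
have : path ltn (rho x) (map rho (rcons p x)) by rewrite path_map.
move/(order_path_min ltn_trans)/allP/(_ (rho x)).
by rewrite map_rcons mem_rcons inE eqxx ltnn => /(_ isT).
Qed.

(* Dhar's burning algorithm: [rho] records the order in which the vertices of
   [A] catch fire, the fire starting outside of [A]. *)
Lemma burning D A :
  (forall S, S \subset A -> S != set0 ->
     exists2 v, v \in S & D v < lap (indicator S) v) ->
  exists rho : vertex G -> nat, (forall v, v \notin A -> rho v = 0%N) /\
    forall v, v \in A ->
      D v < \sum_(e | v \in ends e) (rho (opposite e v) < rho v)%N%:R.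
Proof.
have [n] := ubnP #|A|; elim: n A => // n IHn A An burn.
have [->|A0] := eqVneq A set0.
  by exists (fun=> 0%N); split=> // v; rewrite inE.
have [v vA Dv] := burn A (subxx _) A0.
have [|S SA S0|rho [rho0 rhoD]] := IHn (A :\ v).
- by move: An; rewrite (cardsD1 v A) vA; lia.
- by apply: burn S0; apply: subset_trans SA (subsetDl _ _).
(* The shift puts [v] at time 1, right after the outside at time 0, and keeps the order among the
   rest of [A]. *)
exists (fun u => (rho u + (u \in A))%N); split=> [u uA|u uA].
  by rewrite rho0 ?(negPf uA) // !inE (negPf uA) andbF.
have [->|uv] := eqVneq u v.
  apply: lt_le_trans Dv _; rewrite lapE; apply: ler_sum => e ve.
  rewrite /indicator vA; case: (boolP (_ \in A)) => oA; first by rewrite subrr ler0n.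
  by rewrite [rho v]rho0 ?rho0 ?addn1 ?subr0 // !inE ?eqxx // (negPf oA) andbF.
apply: lt_le_trans (rhoD u _) _; first by rewrite !inE uv.
apply: ler_sum => e ue; rewrite ler_nat uA.
case: (ltnP (rho (opposite e u)) _) => // h.
by have -> : (rho (opposite e u) + (opposite e u \in A) < rho u + true)%N
  by case: (_ \in A); lia.
Qed.

(** If no set of debt-free vertices can fire and stay debt-free, the fire burns everything, and its
    order gives [O]. A vertex in debt has [D v <= -1], below any indegree minus 1. *)
Lemma acyclic_or_legal_firing D :
  (exists O, acyclic O /\ div_le D (orientation_div O)) \/
  (exists S, [/\ S != set0, forall v, v \in S -> 0 <= D v &
     forall v, v \in S -> lap (indicator S) v <= D v]).
Proof.
pose A := [set v | 0 <= D v].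
case: (pselect (exists S, [/\ S \subset A, S != set0 &
  forall v, v \in S -> lap (indicator S) v <= D v])) => [[S [SA S0 legal]]|nlegal].
  by right; exists S; split=> // v /(subsetP SA); rewrite inE.
left; have [S SA S0|rho [_ rhoD]] := @burning D A.
  apply: contrapT => nburn; apply: nlegal; exists S; split=> // v vS.
  by rewrite leNgt; apply/negP => lt; apply: nburn; exists v.
have [O [acO indegO]] := height_orientation rho.
exists O; split=> // v; rewrite orientation_divE.
case: (boolP (v \in A)) => [/rhoD|]; first by rewrite -indegO; lia.
by rewrite inE; lia.
Qed.

(** * Total debt and termination of set firing *)

Lemma lap_indicator_le0 S v : v \notin S -> lap (indicator S) v <= 0.
Proof.
move=> vS; rewrite lapE; apply: sumr_le0 => e _.
by rewrite /indicator (negPf vS) sub0r oppr_le0 ler0n.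
Qed.

(* The value of [f] at a neighbour of [u] is at most [- lap f u] plus
   [valency u] times its value at [u], so bounds propagate along paths. *)
Lemma firing_bounded (b v : vertex G) (K : int) : connect (@adjacent G) b v ->
  exists C : int, forall f : vertex G -> nat, f b = 0%N ->
    (forall u, - lap (fun w => (f w)%:Z) u <= K) -> (f v)%:Z <= C.
Proof.
case/connectP => p; elim/last_ind: p v => [|p w IHp] v /=.
  by move=> _ ->; exists 0 => f ->.
rewrite rcons_path last_rcons => /andP[bp adj] ->.
have [C fC] := IHp _ bp erefl; set u := last b p in adj fC.
exists (K + \sum_(e | u \in ends e) C) => f fb fK.
have {}fC := fC f fb fK; have := fK u.
rewrite lapE -sumrN.
have /existsP[e /eqP ee] := adj.
have ue : u \in ends e by rewrite ee set21.
have oe : opposite e u = w.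
  apply: oppositeE; last by rewrite setUC.
  by apply: contra_eq_neq (ends_card e) => uv; rewrite ee uv setUid cards1.
rewrite [X in X <= K](@int_bigD1 _ e) //=.
rewrite [X in _ <= _ + X](@int_bigD1 _ e) //= oe => fKu.
(* Each other edge contributes at least [- C], because [f] is nonnegative and [f u <= C]. *)
have : - \sum_(i | (u \in ends i) && (i != e)) C <=
  \sum_(i | (u \in ends i) && (i != e)) - ((f u)%:Z - (f (opposite i u))%:Z).
  by rewrite -sumrN; apply: ler_sum => i _; lia.
move: fKu fC; set s : int := \sum_(_ | _) _; set t : int := \sum_(_ | _) _; lia.
Qed.

(** Minus the total debt; maximising it minimises the debt. *)
Definition neg_part D : int := \sum_v Num.min 0 (D v).

Lemma neg_part_le D v : neg_part D <= D v.
Proof.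
rewrite /neg_part (@int_bigD1 _ v) //=.
have : \sum_(i | i != v) Num.min 0 (D i) <= 0.
  by apply: sumr_le0 => u _; lia.
by set s : int := \sum_(_ | _) _; lia.
Qed.

(** The right-hand side is the sum of the positive parts. *)
Lemma le_deg_neg_part D v : D v <= deg D - neg_part D.
Proof.
rewrite /deg /neg_part -sumrB (@int_bigD1 _ v) //=.
have : 0 <= \sum_(i | i != v) (D i - Num.min 0 (D i)).
  by apply: sumr_ge0 => u _; lia.
by set s : int := \sum_(_ | _) _; lia.
Qed.

Lemma lin_equiv_acyclic D : connected_graph G -> ~ equiv_effective D ->
  exists D' O, [/\ acyclic O, lin_equiv D D' & div_le D' (orientation_div O)].
Proof.
move=> conn nD.
have [D1 DD1 D1max] : exists2 D1, lin_equiv D D1 &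
    forall D2, lin_equiv D D2 -> neg_part D2 <= neg_part D1.
  have npart_le0 D2 : neg_part D2 <= 0.
    by apply: sumr_le0 => v _; lia.
  have [||E [DE Eb] Emax] := @max_measure_exists _
    (fun E => lin_equiv D E /\ neg_part D <= neg_part E)
    (fun E => `|neg_part E - neg_part D|%N) `|neg_part D|%N.
  - by exists D; split; [exact: lin_equiv_refl | exact: lexx].
  - by move=> E [_]; have := npart_le0 E; lia.
  exists E => // D2 DD2; case: (leP (neg_part D) (neg_part D2)) => le; last lia.
  by have := Emax D2 (conj DD2 le); lia.
have [b D1b] : exists b, D1 b < 0.
  apply: contrapT => nb; apply: nD; exists D1 => //; apply/effectiveP => v; rewrite leNgt.
  by apply/negP => lt; apply: nb; exists v.
pose fire (f : vertex G -> nat) : divisor G := D1 - lap (fun v => (f v)%:Z).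
have Dfire f : lin_equiv D (fire f).
  by apply: lin_equiv_trans DD1 _; apply/lin_equivP; eexists.
(* Scripts that never fire [b], leave it in debt and keep the total debt least; one with maximal
   total firing is chosen. *)
pose Q f := [/\ f b = 0%N, fire f b < 0 & neg_part (fire f) = neg_part D1].
have [C Cmax] : exists C : vertex G -> int, forall v f, Q f -> (f v)%:Z <= C v.
  (* [- lap f u] is the new value at [u], at most [deg D - neg_part D1], minus [D1 u], at least
     [neg_part D1]. *)
  pose K := deg D - neg_part D1 - neg_part D1.
  have bnd v := firing_bounded K (conn b v).
  have [C CK] := choice bnd; exists C => v f [fb _ fN]; apply: CK => // u.
  have := le_deg_neg_part (fire f) u; rewrite fN -(deg_lin_equiv (Dfire f)).
  by rewrite /K; have := neg_part_le D1 u; rewrite /fire !divBE; lia.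
have [|f Qf|f Qf fmax] := @max_measure_exists _ Q
    (fun f => \sum_v f v)%N `|(\sum_v C v)%R|%N.
- exists (fun=> 0%N); rewrite /Q.
  by have -> : fire (fun=> 0%N) = D1 by rewrite /fire lap0 subr0.
- rewrite -lez_nat -natz natr_sum abszE; apply: le_trans (ler_norm _).
  by apply: ler_sum => v _; rewrite natz; exact: Cmax.
case: (acyclic_or_legal_firing (fire f)) => [[O [acO leO]]|[S [S0 Spos legal]]].
  by exists (fire f), O.
have [fb fneg fN] := Qf.
have bS : b \notin S by apply/negP => /Spos; rewrite leNgt fneg.
pose f' v := (f v + (v \in S))%N.
have fireE : fire f' = fire f - lap (indicator S).
  rewrite /fire /f' -addrA -opprD -lapD; congr (_ - lap _).
  by apply: funext => v; rewrite PoszD /indicator; case: (v \in S).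
(* Legality keeps [S] out of debt, and vertices outside [S] never lose. *)
have min_le v : Num.min 0 (fire f v) <= Num.min 0 (fire f' v).
  rewrite fireE !divBE; case: (boolP (v \in S)) => vS.
    by have := legal v vS; have := Spos v vS; rewrite !divBE; lia.
  by have := lap_indicator_le0 vS; lia.
have N' : neg_part (fire f') = neg_part (fire f).
  by apply/eqP; rewrite eq_le fN D1max //= -fN; apply: ler_sum.
(* The debt was already least, so every term of the sum is unchanged. *)
have f'b : fire f' b < 0.
  have /psumr_eq0P minE : forall v, true ->
      0 <= Num.min 0 (fire f' v) - Num.min 0 (fire f v).
    by move=> v _; rewrite subr_ge0.
  have := minE _ b isT.
  rewrite sumrB -/(neg_part (fire f')) -/(neg_part (fire f)) N' subrr.
  by move=> /(_ erefl); lia.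
have /fmax : Q f' by rewrite /Q /f' fb (negPf bS) N' f'b.
have cardS : (\sum_v (v \in S) = #|S|)%N.
  by rewrite -sum1_card [RHS]big_mkcond; apply: eq_bigr => v _; case: (v \in S).
by rewrite /f' big_split /= cardS; have := card_gt0 S; rewrite S0; lia.
Qed.

(** * Augmentation along directed paths *)

Definition reorient_head O e v : edge G -> option (vertex G) :=
  fun e' => if e' == e then Some v else head O e'.

Lemma reorient_subproof O e v : v \in ends e ->
  forall e' u, reorient_head O e v e' = Some u -> u \in ends e'.
Proof.
move=> ve e' u; rewrite /reorient_head.
by case: eqP => [-> [<-] //|_]; exact: head_ends.
Qed.

Definition reorient O e v (ve : v \in ends e) : partial_orientation G :=
  PartialOrientation (@reorient_subproof O e v ve).

Lemma indeg_reorient O e v (ve : v \in ends e) u :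
  (indeg (reorient O ve) u + (head O e == Some u) = indeg O u + (v == u))%N.
Proof.
have indegE O' : indeg O' u =
    ((head O' e == Some u) + #|[set e' | head O' e' == Some u] :\ e|)%N.
  by rewrite /indeg (cardsD1 e) inE.
rewrite !indegE /= {1}/reorient_head eqxx.
have -> : [set e' | reorient_head O e v e' == Some u] :\ e =
          [set e' | head O e' == Some u] :\ e.
  by apply/setP => e'; rewrite !inE /reorient_head; case: eqP.
by rewrite (inj_eq Some_inj); set n := #|_|; lia.
Qed.

(* Reversing a directed path from [s] to an endpoint of an unoriented edge, and
   then orienting that edge, changes the indegree of [s] only. *)
Lemma augmenting_path O s p e : path (arc O) s p -> uniq (s :: p) ->
  last s p \in ends e -> head O e = None ->
  exists O', forall v, indeg O' v = (indeg O v + (s == v))%N.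
Proof.
elim: p O s => [|w p IHp] O s /=.
  move=> _ _ se he; exists (reorient O se) => v.
  by rewrite -(indeg_reorient O se) he addn0.
case/andP => /arcP[e1 [we1 oe1 he1]] wp /andP[sp up] le he.
have se1 : s \in ends e1 by rewrite -oe1 opposite_ends.
(* Reversing the first arc moves one unit of indegree from [w] to [s]; the recursion from [w]
   restores it. The remaining path avoids [s], so its arcs survive. *)
pose O1 := reorient O se1.
have sw : s != w by move: sp; rewrite inE negb_or => /andP[].
have [||O' indegO'] := IHp O1 w _ up le.
- apply: (@sub_in_path _ (predC1 s)) wp.
    move=> a c; rewrite !inE => sa sc /arcP[e' [ce' oe' he']]; apply/arcP.
    exists e'; split=> //; rewrite /= /reorient_head; case: eqP => // ee1.
    have := se1; rewrite -ee1 (ends_opposite ce') oe' !inE.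
    by rewrite !(eq_sym s) (negPf sa) (negPf sc).
  by apply/allP => u uwp; apply: contraNneq sp => <-.
- rewrite /= /reorient_head; case: eqP => // ee1.
  by rewrite ee1 he1 in he.
exists O' => v; have := indeg_reorient O se1 v; rewrite indegO' he1.
by rewrite (inj_eq Some_inj) -/O1; lia.
Qed.

(** * Excess, reachability and cut reversal *)

Definition excess O E : {set vertex G} := [set v | orientation_div O v < E v].

Definition reach O E : {set vertex G} :=
  [set v | [exists s in excess O E, connect (arc O) s v]].

Lemma reachP O E v :
  reflect (exists2 s, s \in excess O E & connect (arc O) s v) (v \in reach O E).
Proof. by rewrite inE; exact: exists_inP. Qed.

(** An edge with ends on both sides is directed out of [S], whatever its former state; [pick] finds
    its outer end. *)
Definition reverse_cut_head O S : edge G -> option (vertex G) := fun e =>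
  if [pick v in ends e :\: S] is Some v then
    if ends e :&: S == set0 then head O e else Some v
  else head O e.

Lemma reverse_cut_subproof O S e v :
  reverse_cut_head O S e = Some v -> v \in ends e.
Proof.
rewrite /reverse_cut_head; case: pickP => [w|_]; last exact: head_ends.
by rewrite inE => /andP[_ we]; case: eqP => [_|_ [<-] //]; exact: head_ends.
Qed.

Definition reverse_cut O S : partial_orientation G :=
  PartialOrientation (@reverse_cut_subproof O S).

Lemma reverse_cut_same O S e v : v \in ends e ->
  (v \in S) = (opposite e v \in S) -> head (reverse_cut O S) e = head O e.
Proof.
move=> ve vo; rewrite /= /reverse_cut_head (ends_opposite ve).
case: pickP => // w; rewrite !inE => /andP[wS we].
case: eqP => // /eqP/set0Pn[u]; rewrite !inE => /andP[ue uS].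
by move: ue we uS wS => /orP[] /eqP-> /orP[] /eqP->; rewrite ?vo => ->.
Qed.

Lemma reverse_cut_across O S e v : v \in ends e ->
  v \in S -> opposite e v \notin S ->
  head (reverse_cut O S) e = Some (opposite e v).
Proof.
move=> ve vS oS; rewrite /= /reverse_cut_head {1 2}(ends_opposite ve).
have -> : [set opposite e v; v] :&: S == set0 = false.
  by apply/set0Pn; exists v; rewrite !inE eqxx orbT.
case: pickP => [w|/(_ (opposite e v))]; rewrite !inE ?eqxx ?oS //.
by move=> /andP[wS /orP[] /eqP wE]; rewrite wE // vS in wS *.
Qed.

(** When the whole cut points into [S], reversal moves one unit of indegree across each cut edge,
    just as firing [S] does. *)
Lemma indeg_reverse_cut O S :
  (forall e v, v \in ends e -> v \in S -> opposite e v \notin S ->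
     head O e = Some v) ->
  forall v, (indeg (reverse_cut O S) v)%:Z = (indeg O v)%:Z - lap (indicator S) v.
Proof.
move=> cutS v; rewrite !indeg_sum lapE -sumrB; apply: eq_bigr => e ve.
case: (boolP (v \in S)) => vS; case: (boolP (opposite e v \in S)) => oS.
- by rewrite (reverse_cut_same O ve) ?vS ?oS // /indicator vS oS subrr subr0.
- rewrite (reverse_cut_across O ve) // (cutS e v) // /indicator vS (negPf oS).
  by rewrite !(inj_eq Some_inj) (negPf (opposite_neq ve)) eqxx subr0 subrr.
- have := reverse_cut_across O (opposite_ends ve) oS.
  rewrite oppositeK // => ->//; rewrite (cutS _ _ (opposite_ends ve)) ?oppositeK //.
  rewrite /indicator oS (negPf vS) !(inj_eq Some_inj) (negPf (opposite_neq ve)) eqxx.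
  by rewrite !sub0r opprK.
- by rewrite (reverse_cut_same O ve) ?(negPf vS) ?(negPf oS) // /indicator
    (negPf vS) (negPf oS) subrr subr0.
Qed.

Lemma sum_indeg O : (\sum_v indeg O v = #|[set e | head O e]|)%N.
Proof.
rewrite /indeg -[RHS]sum1_card [RHS]big_mkcond /=.
under eq_bigr do rewrite -sum1_card big_mkcond /=.
rewrite exchange_big; apply: eq_bigr => e _ /=; rewrite inE.
case he : (head O e) => [v|] /=.
  rewrite (bigD1 v) //= inE he eqxx big1 // => u uv.
  by rewrite inE he (inj_eq Some_inj) eq_sym (negPf uv).
by rewrite big1 // => v _; rewrite inE he.
Qed.

Lemma connect_cut S : connected_graph G -> S != set0 -> S != setT ->
  exists e v, [/\ v \in ends e, v \in S & opposite e v \notin S].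
Proof.
move=> conn /set0Pn[x xS] ST.
have [y _ yS] : exists2 y, true & y \notin S.
  apply: contrapT => ny; move/eqP: ST; apply; apply/setP => y; rewrite inE.
  by apply: contrapT => /negP yS; apply: ny; exists y.
have /connectP[p] := conn x y; elim: p x xS => [|z p IHp] x xS /=.
  by move=> _ yx; rewrite yx xS in yS.
case/andP => /existsP[e /eqP ee] zp yE.
case: (boolP (z \in S)) => zS; first exact: IHp zS zp yE.
exists e, x; split=> //; first by rewrite ee set21.
rewrite (@oppositeE e z x) // 1?setUC //.
by apply: contraNneq zS => ->.
Qed.

Lemma deg_orientation_div O :
  deg (orientation_div O) = (\sum_v indeg O v)%N%:Z - #|vertex G|%:Z.
Proof.
rewrite /deg (eq_bigr _ (fun v _ => orientation_divE O v)).
rewrite sumrB -[in RHS]natz natr_sum; congr (_ - _).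
  by apply: eq_bigr => v _; rewrite natz.
by rewrite sumr_const natz.
Qed.

(** * Construction of sourceless orientations *)

Lemma equiv_orientation_div D :
  connected_graph G -> deg D <= genus G - 1 -> equiv_effective D ->
  exists O, sourceless O /\ lin_equiv D (orientation_div O).
Proof.
move=> conn degD [E0 effE0 DE0].
pose P (x : divisor G * partial_orientation G) :=
  [/\ effective x.1, lin_equiv D x.1 & div_le (orientation_div x.2) x.1].
(* The weight exceeds any size of [reach], so the comparison is lexicographic. *)
pose m (x : divisor G * partial_orientation G) :=
  ((\sum_v indeg x.2 v) * #|vertex G|.+1 + #|reach x.2 x.1|)%N.
have [|x Px|[E O] [/= effE DE leE] xmax] := @max_measure_exists _ P m
    (#|edge G| * #|vertex G|.+1 + #|vertex G|)%N.
- have hd e v : (fun _ : edge G => @None (vertex G)) e = Some v -> v \in ends e by [].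
  exists (E0, PartialOrientation hd); split=> //= v.
  rewrite orientation_divE; move/effectiveP/(_ v): effE0.
  have -> : indeg (PartialOrientation hd) v = 0%N; last by lia.
  by apply: eq_card0 => e; rewrite inE.
- by rewrite leq_add ?max_card // leq_mul // sum_indeg max_card.
have [ex0|/set0Pn[s0 s0x]] := eqVneq (excess O E) set0.
  have EO : E = orientation_div O.
    apply/ffunP => v; apply/eqP; rewrite eq_le leE andbT leNgt.
    by apply/negP => lt; move/setP/(_ v): ex0; rewrite !inE lt.
  exists O; split; last by rewrite -EO.
  move=> v src; move/effectiveP/(_ v): effE; rewrite EO orientation_divE.
  have -> : indeg O v = 0%N; last by [].
  by apply: eq_card0 => e; rewrite inE; apply/eqP; exact: src.
set S := reach O E.
have SS : excess O E \subset S.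
  by apply/subsetP => s sx; apply/reachP; exists s.
have S_arc u v : u \in S -> arc O u v -> v \in S.
  case/reachP => s sx su uv; apply/reachP; exists s => //.
  exact: connect_trans su (connect1 uv).
have S_oriented e v : v \in ends e -> v \in S -> head O e <> None.
  move=> ve /reachP[s sx /connectP[p]]; case/shortenP => p' sp us _ vE he.
  (* As [s] has excess, raising its indegree by 1 stays below [E]. *)
  rewrite vE in ve; have [O' indegO'] := augmenting_path sp us ve he.
  have /xmax : P (E, O').
    split=> //= v'; rewrite orientation_divE indegO'.
    move: sx; rewrite inE; have := leE v'; rewrite !orientation_divE.
    by case: eqP => [<-|_]; lia.
  rewrite /m /=; under eq_bigr do rewrite indegO'.
  have sum1 : (\sum_v' (s == v') = 1)%N.
    rewrite (bigD1 s) //= eqxx big1 // => v' v's.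
    by rewrite eq_sym (negPf v's).
  rewrite big_split /= sum1 addn1 mulSn; have : (#|reach O E| <= #|vertex G|)%N := max_card _.
  set k := (_ * _)%N; move: (#|vertex G|) k => n k.
  by move: #|_| => a; move: #|_| => b; lia.
have cutS e v : v \in ends e -> v \in S -> opposite e v \notin S -> head O e = Some v.
  move=> ve vS oS; case he : (head O e) => [w|]; last by case: (S_oriented e v).
  have := head_ends he; rewrite (ends_opposite ve) !inE => /orP[] /eqP wE; rewrite wE //.
  case/negP: oS; apply: S_arc vS _; apply/arcP; exists e.
  by rewrite opposite_ends // oppositeK // he wE.
have indeg' := indeg_reverse_cut cutS.
set O' := reverse_cut O S in indeg'.
pose E' := E - lap (indicator S).
have excessE : excess O' E' = excess O E.
  by apply/setP => v; rewrite !inE !orientation_divE divBE indeg'; lia.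
(* Otherwise every edge is oriented, so [orientation_div O] has degree [genus G - 1], yet [E] has
   larger degree. *)
have SV : S != setT.
  apply/eqP => ST.
  have : deg (orientation_div O) < deg E.
    rewrite /deg [ltLHS](@int_bigD1 _ s0) // [ltRHS](@int_bigD1 _ s0) //.
    rewrite ltr_leD ?ler_sum //.
    by move: s0x; rewrite inE.
  rewrite -(deg_lin_equiv DE) deg_orientation_div sum_indeg.
  have -> : #|[set e | head O e]| = #|edge G|.
    apply: eq_card => e; rewrite !inE.
    have /card_gt0P[v ve] : (0 < #|ends e|)%N by rewrite ends_card.
    by case he : (head O e) => //; case: (S_oriented e v); rewrite // ST inE.
  by move: degD; rewrite /genus; lia.
have S0 : S != set0 by apply/set0Pn; exists s0; exact: (subsetP SS).
have arcS u v : u \in S -> arc O u v -> arc O' u v.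
  move=> uS uv; have vS := S_arc _ _ uS uv.
  case/arcP: uv => e [ve oe he]; apply/arcP; exists e; split=> //.
  by rewrite (reverse_cut_same O ve) // oe uS vS.
(* Paths from the excess stay inside [S], where no edge is reversed. *)
have SS' : S \subset reach O' E'.
  apply/subsetP => v /reachP[s sx /connectP[p sp ->]]; apply/reachP.
  rewrite excessE; exists s => //; apply/connectP; exists p => //.
  have := subsetP SS _ sx.
  elim: p s sp {sx} => //= w p IHp s /andP[sw wp] sS.
  by rewrite arcS // IHp // (S_arc _ _ sS sw).
have [e [v [ve vS oS]]] := connect_cut conn S0 SV.
(* A reversed cut edge now leads out of [S], so the reachable set grows. *)
have oS' : opposite e v \in reach O' E'.
  have /subsetP/(_ v vS)/reachP[s sx sv] := SS'.
  apply/reachP; exists s => //; apply: connect_trans sv (connect1 _).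
  apply/arcP; exists e; rewrite opposite_ends // oppositeK //.
  by rewrite (reverse_cut_across O ve).
have /xmax : P (E', O').
  split=> /=; last 1 first.
  - by move=> u; have := leE u; rewrite !orientation_divE divBE indeg'; lia.
  - apply/effectiveP => u; rewrite divBE.
    case: (boolP (u \in S)) => uS; last first.
      by have := lap_indicator_le0 uS; move/effectiveP/(_ u): effE; lia.
    have := leE u; have := indeg' u; rewrite orientation_divE.
    have [ux|uNx] := boolP (u \in excess O E).
      by move: ux; rewrite inE orientation_divE; lia.
    (* Without excess, [u] is entered by an arc inside [S], which the reversal keeps; hence
       [E' u >= 0]. *)
    suff : (0 < indeg O' u)%N by clear; lia.
    case/reachP: uS => s sx /connectP[p]; case/lastP: p => [|p w].
      by move=> _ us; rewrite us sx in uNx.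
    rewrite rcons_path last_rcons => /andP[sp lw] ->.
    have /(arcS _ _) : last s p \in S by apply/reachP; exists s => //; apply/connectP; exists p.
    case/(_ _ lw)/arcP => e' [_ _ he']; apply/card_gt0P; exists e'.
    by rewrite inE he'.
  - by apply: lin_equiv_trans DE _; apply/lin_equivP; eexists.
rewrite /m /=.
(* The two orientation divisors are equivalent, so they have equal degree. *)
have -> : (\sum_v indeg O' v = \sum_v indeg O v)%N.
  have : deg (orientation_div O) = deg (orientation_div O').
    apply: deg_lin_equiv; apply/lin_equivP; exists (indicator S).
    by apply/ffunP => u; rewrite divBE !orientation_divE indeg'; lia.
  by rewrite !deg_orientation_div; lia.
rewrite leq_add2l leqNgt proper_card // properE SS'.
by apply: contra oS => /subsetP; exact.
Qed.

End Graph.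

(** * Rank in terms of partial orientations *)

Theorem theorem1p3 (G : multigraph) (D : divisor G) :
  connected_graph G -> deg D <= genus G - 1 ->
  (rank D = -1 <->
     exists (D' : divisor G) (O : partial_orientation G),
       [/\ acyclic O, lin_equiv D D' & div_le D' (orientation_div O)]) /\
  (0 <= rank D <->
     exists O : partial_orientation G,
       sourceless O /\ lin_equiv D (orientation_div O)).
Proof.
move=> conn degD; split; [rewrite rank_lt0 | rewrite rank_ge0]; split.
- exact: lin_equiv_acyclic.
- move=> [D' [O [acO DD' leD']]] [E effE DE].
  apply: acyclic_not_equiv_effective acO leD' _; exists E => //.
  exact: lin_equiv_trans (lin_equiv_sym DD') DE.
- exact: equiv_orientation_div.
- move=> [O [srcO DO]]; exists (orientation_div O) => //.
  apply/effectiveP => v; rewrite orientation_divE.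
  suff : (0 < indeg O v)%N by lia.
  rewrite lt0n; apply/negP => /eqP/card0_eq v0; apply: (srcO v) => e he.
  by have := v0 e; rewrite !inE he eqxx.
Qed.
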